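(* Let $pod_2(n)$ be defined by $\sum_{n\ge 0} pod_2(n)q^n = \frac{\psi(-q^2)}{\psi(-q)} = \frac{f_2^2 f_8}{f_1 f_4^2}$. Let $p$ be a prime with $p\equiv 7\pmod 8$, and let $r$ be an integer with $1\le r<8p$, $r\equiv 7 \pmod 8$ and $\gcd(r,p)=1$. Then for all $n\ge 0$ and $k\ge 0$, $$pod_2\!\left(p^{2k+2}n + \frac{rp^{2k+1}-1}{8}\right)\equiv 0 \pmod 8.$$
   Context: For $|q|<1$ and integers $j\ge 1$, $f_j := \prod_{n=1}^{\infty}(1-q^{jn})$. Ramanujan's theta function is $\psi(q) := \sum_{n=0}^{\infty} q^{n(n+1)/2} = f_2^2/f_1$, so that $\psi(-q) = f_1f_4/f_2$. The paper describes $pod_2(n)$ as the number of $2$-regular partitions of $n$ with distinct odd parts (even parts unrestricted), with generating function $\sum_{n\ge0} pod_2(n)q^n = \psi(-q^2)/\psi(-q)$. *)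

(* Defs.v *)
From mathcomp Require Import all_boot all_order all_algebra.

Set Implicit Arguments.
Unset Strict Implicit.
Unset Printing Implicit Defensive.

Import GRing.Theory.
Local Open Scope ring_scope.

(* The q-series are formal power series with integer coefficients:            *)
(* F : fps stands for \sum_n F n q^n.                                         *)
Definition fps := nat -> int.

Definition fps_mul (F G : fps) : fps :=
  fun n => \sum_(i < n.+1) F i * G (n - i)%N.

(* F(c q^d); meaningful for 0 < d. *)
Definition fps_subst (c : int) (d : nat) (F : fps) : fps :=
  fun n => if (d %| n)%N then c ^+ (n %/ d) * F (n %/ d)%N else 0.

(* The first n coefficients of F / G when G has constant term 1, from         *)
(* F n = \sum_(i <= n) H i * G (n - i) solved for H n.                        *)
Fixpoint fps_div_seq (F G : fps) (n : nat) : seq int :=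
  if n is m.+1 then
    let s := fps_div_seq F G m in
    rcons s (F m - \sum_(i < m) s`_i * G (m - i)%N)
  else [::].

Definition fps_div (F G : fps) : fps := fun n => (fps_div_seq F G n.+1)`_n.

(* psi(q) = \sum_(m >= 0) q^(m(m+1)/2). Only m <= n can contribute to the     *)
(* coefficient of q^n, since m <= m(m+1)/2.                                   *)
Definition psi : fps :=
  fun n => \sum_(m < n.+1) ((m * m.+1) %/ 2 == n)%N%:R.

Definition pod2 : fps :=
  fps_div (fps_subst (-1) 2 psi) (fps_subst (-1) 1 psi).

Lemma size_fps_div_seq F G n : size (fps_div_seq F G n) = n.
Proof. by elim: n => //= n IHn; rewrite size_rcons IHn. Qed.

Lemma nth_fps_div_seq F G n i :
  (i < n)%N -> (fps_div_seq F G n)`_i = fps_div F G i.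
Proof.
elim: n => // n IHn; rewrite ltnS leq_eqVlt => /predU1P[-> //|lt_in].
by rewrite /= nth_rcons size_fps_div_seq lt_in IHn.
Qed.

Lemma fps_divK F G : G 0%N = 1 -> fps_mul (fps_div F G) G =1 F.
Proof.
move=> G0 n; rewrite /fps_mul big_ord_recr /= subnn G0 mulr1.
rewrite {2}/fps_div /= nth_rcons size_fps_div_seq ltnn eqxx.
under [X in _ + (_ - X)]eq_bigr => i _ do rewrite nth_fps_div_seq //.
by rewrite addrC subrK.
Qed.

Lemma fps_mulIr F F' G :
  G 0%N = 1 -> fps_mul F G =1 fps_mul F' G -> F =1 F'.
Proof.
move=> G0 eqFG n; elim/ltn_ind: n => n IHn; have := eqFG n.
rewrite /fps_mul !big_ord_recr /= subnn G0 !mulr1.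
by under eq_bigr => i _ do rewrite IHn //; move/addrI.
Qed.

(* The defining equation pod2(q) psi(-q) = psi(-q^2); by fps_mulIr it         *)
(* determines pod2.                                                           *)
Lemma pod2_gf :
  fps_mul pod2 (fps_subst (-1) 1 psi) =1 fps_subst (-1) 2 psi.
Proof.
by apply: fps_divK; rewrite /fps_subst /psi /= big_ord1 /= expr0 mul1r.
Qed.

(* Main.v *)
Require Import Defs.
From mathcomp Require Import all_boot all_order all_algebra.
From mathcomp Require Import zify ring.

(** The product [psi(q) psi(-q)], written as a double sum over pairs of integers
[(i, j)] with sign [(-1)^j] and exponent [i (2 i + 1) + j (2 j + 1)], loses the terms
with [i - j] odd to the exchange of [i] and [j]; the substitution [i = s + t],
[j = s - t] turns the others into [psi(-q^2) phi(-q^4)]. Hence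
[sum pod2(n) q^n = psi(q) / phi(-q^4)], and with [phi(-q^4) = 1 + 2 T],
[T = sum_(t >= 1) (-1)^t q^(4 t^2)], this is [psi - 2 psi T + 4 psi T^2] modulo [8].
Modulo [2] only the diagonal of [T^2] survives, so [pod2(N)] can be nonzero modulo
[8] only if [8 N + 1] has the form [x^2 + 32 a^2] or [x^2 + 64 a^2]. For
[p = 7] modulo [8], neither [-2] nor [-1] is a square modulo [p], so numbers of these
forms are divisible by [p] to an even power, contrary to [8 N + 1 = p^(2 k + 1) m]. *)

Set Implicit Arguments.
Unset Strict Implicit.
Unset Printing Implicit Defensive.

Import Order.TTheory GRing.Theory Num.Theory.
Local Open Scope ring_scope.

(** * Arithmetic of formal power series *)

Lemma eq_fps_mul F F' G G' : F =1 F' -> G =1 G' -> fps_mul F G =1 fps_mul F' G'.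
Proof. by move=> eqF eqG n; apply: eq_bigr => i _; rewrite eqF eqG. Qed.

(** The coefficient of degree [n] only sees degrees up to [n], so truncation transfers the ring laws
    from [{poly int}]. *)
Lemma fps_mul_coefM F G (P Q : {poly int}) n :
    (forall i, (i <= n)%N -> P`_i = F i) -> (forall i, (i <= n)%N -> Q`_i = G i) ->
  fps_mul F G n = (P * Q)`_n.
Proof.
move=> eqF eqG; rewrite coefM; apply: eq_bigr => i _.
by rewrite eqF ?eqG ?leq_subr // -ltnS.
Qed.

Lemma coef_fps_poly (F : fps) n i : (i <= n)%N -> (\poly_(i < n.+1) F i)`_i = F i.
Proof. by rewrite coef_poly ltnS => ->. Qed.

Lemma fps_mulC F G : fps_mul F G =1 fps_mul G F.
Proof.
move=> n; rewrite !(fps_mul_coefM (@coef_fps_poly _ n) (@coef_fps_poly _ n)).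
by rewrite mulrC.
Qed.

Lemma fps_mulA F G H : fps_mul F (fps_mul G H) =1 fps_mul (fps_mul F G) H.
Proof.
move=> n; pose P F := \poly_(i < n.+1) (F : fps) i.
rewrite (@fps_mul_coefM _ _ (P F) (P G * P H)) ?mulrA; last 2 first.
- exact: coef_fps_poly.
- move=> i le_in; apply/esym/fps_mul_coefM => j le_ji;
    exact: coef_fps_poly (leq_trans le_ji le_in).
apply/esym/fps_mul_coefM; last exact: coef_fps_poly.
move=> i le_in; apply/esym/fps_mul_coefM => j le_ji;
  exact: coef_fps_poly (leq_trans le_ji le_in).
Qed.

Lemma fps_mulBl (c : int) F F' G n :
  fps_mul (fun i => F i - c * F' i) G n = fps_mul F G n - c * fps_mul F' G n.
Proof.
by rewrite /fps_mul mulr_sumr -sumrB; apply: eq_bigr => i _; rewrite mulrBl mulrA.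
Qed.

(** The expansions are required only up to degree [n], so that finite index lists can stand for
    infinite sums. *)
Lemma fps_mul_monomials (I J : Type) (s : seq I) (t : seq J) (c : I -> int)
    (d : J -> int) (e : I -> nat) (f : J -> nat) F G n :
    (forall i, (i <= n)%N -> F i = \sum_(a <- s) c a * (e a == i)%:R) ->
    (forall i, (i <= n)%N -> G i = \sum_(b <- t) d b * (f b == i)%:R) ->
  fps_mul F G n = \sum_(a <- s) \sum_(b <- t) c a * d b * (e a + f b == n)%N%:R.
Proof.
move=> eqF eqG; transitivity (\sum_(i < n.+1) \sum_(a <- s) \sum_(b <- t)
    c a * d b * ((e a == i) && (f b == n - i)%N)%:R).
  apply: eq_bigr => i _; rewrite eqF ?eqG ?leq_subr //; last by rewrite -ltnS.
  rewrite mulr_suml; apply: eq_bigr => a _; rewrite mulr_sumr.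
  by apply: eq_bigr => b _; rewrite -mulnb natrM; ring.
rewrite exchange_big; apply: eq_bigr => a _; rewrite exchange_big.
apply: eq_bigr => b _; rewrite -mulr_sumr; congr (_ * _).
have [le_an | lt_na] := leqP (e a) n; last first.
  rewrite big1 => [|i _]; first by case: eqP => //; lia.
  by case: eqP => //=; have := ltn_ord i; lia.
rewrite (bigD1 (Ordinal (le_an : e a < n.+1)%N)) //= eqxx big1 ?addr0 => [|i].
  by congr (_%:R); lia.
by rewrite -val_eqE /= eq_sym => /negbTE ->.
Qed.

(* The cross terms of the square cancel in pairs modulo 2. *)
Lemma fps_sqr_mod2 F n :
  exists z, fps_mul F F n = 2 * z + (~~ odd n)%:R * F n./2 ^+ 2.
Proof.
pose g i := F i * F (n - i)%N.
have g_sym i : (i <= n)%N -> g (n - i)%N = g i.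
  by move=> le_in; rewrite /g subKn // mulrC.
(* The indices below [h] and those from [h'] on mirror each other under [i -> n - i]; between them
   lies [n./2] alone if [n] is even, nothing if [n] is odd. *)
pose h := (n.+1)./2; pose h' := (n./2).+1.
have upper : \sum_(h' <= i < n.+1) g i = \sum_(0 <= i < h) g i.
  rewrite big_nat_rev /= -{1}[h']add0n big_addn.
  have -> : (n.+1 - h' = h)%N by lia.
  apply: eq_big_nat => i /andP[_ lt_ih]; rewrite -[RHS]g_sym; last by lia.
  by congr g; lia.
have middle : \sum_(h <= i < h') g i = (~~ odd n)%:R * F n./2 ^+ 2.
  have [n_odd | n_even] := boolP (odd n); first by rewrite mul0r big_geq //; lia.
  have -> : h' = h.+1 by lia.
  rewrite big_nat1 mul1r /g; have -> : (n - h = n./2)%N by lia.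
  by have -> : h = n./2 by lia.
exists (\sum_(0 <= i < h) g i); rewrite /fps_mul -(big_mkord xpredT g).
rewrite (big_cat_nat (n := h)) //=; last by lia.
rewrite (big_cat_nat (m := h) (n := h')) //=; try lia.
by rewrite upper middle; ring.
Qed.

(** * Sums over the integers and theta series *)

(** Only indices satisfying [P] and [Q] must correspond: a change of variables need not map box onto
    box, but it matches the terms of a fixed degree. *)
Lemma big_reindex_seq (I J : eqType) (s : seq I) (t : seq J) (P : pred I)
    (Q : pred J) (h : J -> I) (g : I -> J) (F : I -> int) (G : J -> int) :
    uniq s -> uniq t ->
    (forall a, a \in s -> P a -> [/\ g a \in t, Q (g a) & h (g a) = a]) ->
    (forall b, b \in t -> Q b -> [/\ h b \in s, P (h b), g (h b) = b & F (h b) = G b]) ->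
  \sum_(a <- s | P a) F a = \sum_(b <- t | Q b) G b.
Proof.
move=> s_uniq t_uniq gP hP; rewrite -[RHS]big_filter.
rewrite (@eq_big_seq _ _ _ _ _ G (F \o h)); last first.
  by move=> b; rewrite mem_filter => /andP[Qb tb]; have [] := hP b tb Qb.
rewrite -[RHS](big_map h xpredT F) -[LHS]big_filter.
apply: perm_big; apply: uniq_perm; first exact: filter_uniq.
  rewrite map_inj_in_uniq ?filter_uniq // => b c; rewrite !mem_filter.
  move=> /andP[Qb tb] /andP[Qc tc] eq_h.
  by have [_ _ <- _] := hP b tb Qb; have [_ _ <- _] := hP c tc Qc; rewrite eq_h.
move=> a; apply/idP/mapP => [|[b]]; rewrite mem_filter => /andP[].
  move=> Pa sa; have [tga Qga hga] := gP a sa Pa.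
  by exists (g a); rewrite // mem_filter Qga.
by move=> Qb tb ->; rewrite mem_filter; have [-> -> _ _] := hP b tb Qb.
Qed.

Lemma sum_indicator (I : Type) (s : seq I) (P Q : pred I) (c : I -> int) :
  \sum_(a <- s | P a) c a * (Q a)%:R = \sum_(a <- s | P a && Q a) c a.
Proof.
by rewrite big_mkcondr; apply: eq_bigr => a _; case: ifP; rewrite ?mulr1 ?mulr0.
Qed.

Definition zrange B : seq int := map Posz (iota 0 B.+1) ++ map Negz (iota 0 B).

Lemma mem_zrange B z : (z \in zrange B) = (`|z| <= B)%N.
Proof.
rewrite mem_cat; case: z => m.
  rewrite (mem_map (f := Posz)) => [|? ? []] //; rewrite mem_iota.
  by rewrite (_ : Posz m \in map Negz _ = false) ?orbF //; apply/mapP => -[].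
rewrite (mem_map (f := Negz)) => [|? ? []] //; rewrite mem_iota.
by rewrite (_ : Negz m \in map Posz _ = false) //; apply/mapP => -[].
Qed.

Lemma zrange_uniq B : uniq (zrange B).
Proof.
rewrite cat_uniq !map_inj_uniq ?iota_uniq ?andbT => [|? ? []|? ? []] //=.
by apply/hasPn => _ /mapP[m _ ->]; apply/negP => /mapP[].
Qed.

Definition zbox B : seq (int * int) := [seq (i, j) | i <- zrange B, j <- zrange B].

Lemma mem_zbox B x : (x \in zbox B) = (`|x.1| <= B)%N && (`|x.2| <= B)%N.
Proof.
rewrite -!mem_zrange; apply/allpairsP/andP => [[y [? ? ->]] | [? ?]] //.
by exists x; split=> //; exact: surjective_pairing.
Qed.

Lemma zbox_uniq B : uniq (zbox B).
Proof. by apply: allpairs_uniq; rewrite ?zrange_uniq // => -[? ?] [? ?]. Qed.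

(* As i ranges over the integers, [i (2 i + 1)] runs once through the triangular
   numbers. *)
Definition zhex (i : int) : nat := absz (i * (2 * i + 1)).

Lemma zhexE i : Posz (zhex i) = i * (2 * i + 1).
Proof. by rewrite /zhex gez0_abs //; nia. Qed.

(** Every index contributing to a degree at most [B] thus lies in [zrange B]. *)
Lemma absz_le_zhex i : (`|i| <= zhex i)%N.
Proof. by rewrite /zhex abszM leq_pmulr //; lia. Qed.

Lemma odd_zhex i : odd (zhex i) = odd `|i|.
Proof. by rewrite /zhex abszM oddM; lia. Qed.

(** The even [m] come from [i >= 0], the odd ones from [i < 0]. *)
Lemma triangular_zindex (i : int) :
  let m := if 0 <= i then absz (2 * i) else absz (2 * i + 1) in
  (m * m.+1 %/ 2)%N = zhex i.
Proof.
move=> m; have eq_m : (m * m.+1 = zhex i * 2)%N.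
  by have := zhexE i; rewrite /m; case: leP; nia.
by rewrite eq_m mulnK.
Qed.

Lemma psi_zsum B n : (n <= B)%N ->
  psi n = \sum_(i <- zrange B) (zhex i == n)%N%:R.
Proof.
move=> le_nB; rewrite /psi -(big_mkord xpredT (fun m => (m * m.+1 %/ 2 == n)%N%:R)).
under eq_bigr do rewrite -[_%:R]mul1r.
under [RHS]eq_bigr do rewrite -[_%:R]mul1r.
rewrite !sum_indicator /=.
pose h (i : int) := if 0 <= i then absz (2 * i) else absz (2 * i + 1).
pose g m := if odd m then - Posz (m.+1)./2 else Posz m./2.
have gK m : h (g m) = m by rewrite /h /g; case: ifP; case: ifP; lia.
have hK i : g (h i) = i by rewrite /h /g; case: ifP; case: ifP; lia.
have h_tri i : (h i * (h i).+1 %/ 2)%N = zhex i.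
  exact: triangular_zindex.
apply: (big_reindex_seq (h := h) (g := g)) => [||m|i].
- exact: iota_uniq.
- exact: zrange_uniq.
- rewrite mem_index_iota mem_zrange => /andP[_ lt_mn] /eqP e_m.
  rewrite -h_tri gK e_m; split=> //.
  by rewrite /g; case: ifP; lia.
rewrite mem_zrange mem_index_iota => _ /eqP e_i; rewrite h_tri e_i eqxx hK.
split=> //=; rewrite ltnS -e_i -h_tri leq_divRL //.
by case: (h i) => [|m] //; rewrite leq_mul2l.
Qed.

Lemma eq_signr_odd m n : odd m = odd n -> (-1) ^+ m = (-1) ^+ n :> int.
Proof. by move=> eq_mn; rewrite -signr_odd eq_mn signr_odd. Qed.

(** The exponent [zhex i] has the parity of [i], which gives the sign. *)
Lemma psi_neg_zsum B n : (n <= B)%N ->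
  fps_subst (-1) 1 psi n =
  \sum_(i <- zrange B) (-1) ^+ `|i|%N * (zhex i == n)%N%:R.
Proof.
move=> le_nB; rewrite /fps_subst dvd1n divn1 (psi_zsum le_nB) mulr_sumr.
apply: eq_bigr => i _; case: eqP => [<-|]; rewrite ?mulr0 // !mulr1.
exact/eq_signr_odd/odd_zhex.
Qed.

Lemma psi_neg_sqr_zsum B n : (n <= B)%N ->
  fps_subst (-1) 2 psi n =
  \sum_(i <- zrange B) (-1) ^+ `|i|%N * (2 * zhex i == n)%N%:R.
Proof.
move=> le_nB; rewrite /fps_subst; case: ifP => [/dvdnP[m eq_nm] | ndiv].
  rewrite eq_nm mulnK // (@psi_zsum B) ?mulr_sumr; last by lia.
  apply: eq_bigr => i _; rewrite mulnC eqn_pmul2r //.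
  case: eqP => [<-|]; rewrite ?mulr0 // !mulr1.
  exact/eq_signr_odd/odd_zhex.
rewrite big1 // => i _; case: eqP => [eq_n|]; rewrite ?mulr0 //.
by rewrite -eq_n dvdn_mulr in ndiv.
Qed.

(* The q-series of [phi(-q^4)] and [(phi(-q^4) - 1) / 2]. *)
Definition phi_neg4 : fps :=
  fun n => \sum_(t <- zrange n) (-1) ^+ `|t|%N * (4 * `|t| ^ 2 == n)%N%:R.

Definition half_phi_neg4 : fps :=
  fun n => \sum_(0 <= t < n) (-1) ^+ t.+1 * (4 * t.+1 ^ 2 == n)%N%:R.

(** The indices [t] and [-t] contribute equally. *)
Lemma phi_neg4E n : phi_neg4 n = (n == 0)%N%:R + 2 * half_phi_neg4 n.
Proof.
rewrite /phi_neg4 /half_phi_neg4 big_cat /= !big_map /=.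
have -> : iota 0 n = index_iota 0 n by rewrite /index_iota subn0.
have -> : iota 1 n = map succn (index_iota 0 n).
  by rewrite /index_iota subn0 -(iotaDl 1).
by rewrite big_cons !big_map expr0 mul1r eq_sym mulr_natl mulr2n addrA.
Qed.

Lemma zbox_sum B (W : int -> int -> int) :
  \sum_(i <- zrange B) \sum_(j <- zrange B) W i j = \sum_(x <- zbox B) W x.1 x.2.
Proof. by rewrite big_allpairs. Qed.

Lemma phi_neg4_zsum B n : (n <= B)%N ->
  phi_neg4 n = \sum_(t <- zrange B) (-1) ^+ `|t|%N * (4 * `|t| ^ 2 == n)%N%:R.
Proof.
move=> le_nB; rewrite /phi_neg4 !sum_indicator /=.
apply: (big_reindex_seq (h := id) (g := id)); rewrite ?zrange_uniq // => t;
  rewrite !mem_zrange /= => le_t /eqP eq_t; rewrite eq_t eqxx; split=> //; lia || nia.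
Qed.

(** * The theta identity and the expansion of [pod2] modulo 8 *)

Lemma psi_mul_psi_neg :
  fps_mul psi (fps_subst (-1) 1 psi) =1 fps_mul (fps_subst (-1) 2 psi) phi_neg4.
Proof.
move=> n; have psiE i : (i <= n)%N ->
  psi i = \sum_(a <- zrange n) 1 * (zhex a == i)%N%:R.
  by move=> /psi_zsum ->; apply: eq_bigr => a _; rewrite mul1r.
rewrite (fps_mul_monomials psiE (@psi_neg_zsum n)).
rewrite (fps_mul_monomials (@psi_neg_sqr_zsum n) (@phi_neg4_zsum n)) !zbox_sum.
rewrite (bigID (fun x => odd (absz (x.1 - x.2)))) !sum_indicator /=.
set A := (X in X + _ = _).
(* The exchange keeps the exponent and, [i - j] being odd, flips the sign. *)
have A_anti : A = - A.
  rewrite -sumrN; pose swap (x : int * int) := (x.2, x.1).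
  apply: (big_reindex_seq (h := swap) (g := swap)); rewrite ?zbox_uniq //.
    move=> [i j]; rewrite !mem_zbox /= => /andP[-> ->] /andP[ij_odd /eqP eq_n].
    by rewrite addnC eq_n eqxx; split=> //; lia.
  move=> [i j]; rewrite !mem_zbox /= => /andP[-> ->] /andP[ij_odd /eqP eq_n].
  rewrite addnC eq_n eqxx; split=> //; first by lia.
  by rewrite !mul1r -[RHS]mulN1r -exprS; apply: eq_signr_odd; lia.
have -> : A = 0 by lia.
rewrite add0r; apply: (big_reindex_seq
  (h := fun y : int * int => (y.1 + y.2, y.1 - y.2))
  (g := fun x : int * int => ((x.1 + x.2) %/ 2, (x.1 - x.2) %/ 2)%Z));
  rewrite ?zbox_uniq // => -[i j]; rewrite !mem_zbox /= => /andP[le_i le_j].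
  move=> /andP[ij_even /eqP eq_n].
  have [s eq_s] : exists s, i + j = s * 2 by exists ((i + j) %/ 2)%Z; lia.
  have [t eq_t] : exists t, i - j = t * 2 by exists ((i - j) %/ 2)%Z; lia.
  rewrite eq_s eq_t !mulzK //.
  have [eq_i eq_j] : i = s + t /\ j = s - t by split; lia.
  (* The linear terms in [t] cancel, and [2 (s + t)^2 + 2 (s - t)^2 = 4 s^2 + 4 t^2]. *)
  have eq_st : (2 * zhex s + 4 * `|t| ^ 2)%N = n.
    have := zhexE s; have := zhexE i; have := zhexE j; rewrite -eq_n eq_i eq_j.
    by rewrite -mulnn; nia.
  rewrite eq_st eqxx; split=> //; last by rewrite eq_i eq_j.
  have le_s := absz_le_zhex s; rewrite -mulnn in eq_st.
  by apply/andP; split; nia.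
move=> /eqP eq_n.
have eq_ij : (zhex (i + j) + zhex (i - j))%N = n.
  have := zhexE i; have := zhexE (i + j); have := zhexE (i - j).
  by rewrite -eq_n -mulnn; nia.
rewrite eq_ij eqxx; split.
- have := absz_le_zhex (i + j); have := absz_le_zhex (i - j); lia.
- by lia.
- by congr (_, _); lia.
by rewrite mul1r -exprD; apply: eq_signr_odd; lia.
Qed.

(** Both sides agree after multiplication by [psi(-q)], which has constant term 1 and so cancels. *)
Lemma pod2_mul_phi_neg4 : fps_mul pod2 phi_neg4 =1 psi.
Proof.
apply: (@fps_mulIr _ _ (fps_subst (-1) 1 psi)).
  by rewrite /fps_subst /psi /= big_ord1 /= expr0 mul1r.
move=> n; rewrite psi_mul_psi_neg -fps_mulA.
rewrite (eq_fps_mul (frefl _) (fps_mulC _ _)) fps_mulA.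
exact: eq_fps_mul pod2_gf (frefl _) n.
Qed.

Lemma pod2_rec n : pod2 n = psi n - 2 * fps_mul pod2 half_phi_neg4 n.
Proof.
rewrite -pod2_mul_phi_neg4 (eq_fps_mul (frefl _) phi_neg4E) !(fps_mulC pod2).
rewrite -[X in X - _](_ : pod2 n + 2 * fps_mul half_phi_neg4 pod2 n = _) ?addrK //.
rewrite /fps_mul mulr_sumr; under [RHS]eq_bigr do rewrite mulrDl -mulrA.
rewrite big_split /=; congr (_ + _).
by rewrite big_ord_recl subn0 mul1r big1 ?addr0 // => i _; rewrite mul0r.
Qed.

Lemma pod2_mod8 n : exists z, pod2 n = psi n - 2 * fps_mul psi half_phi_neg4 n
  + 4 * fps_mul psi (fps_mul half_phi_neg4 half_phi_neg4) n + 8 * z.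
Proof.
set T := half_phi_neg4.
have recM G m : fps_mul pod2 G m = fps_mul psi G m - 2 * fps_mul (fps_mul pod2 T) G m.
  by rewrite (eq_fps_mul pod2_rec (frefl _)) fps_mulBl.
(* Three uses of [pod2_rec] leave the remainder [-8 pod2 T^3]. *)
exists (- fps_mul (fps_mul pod2 T) (fps_mul T T) n).
by rewrite pod2_rec recM -fps_mulA recM; ring.
Qed.

(** * Supports of the theta series *)

Lemma psi_neq0 n : psi n != 0 -> exists m, (8 * n + 1 = (2 * m + 1) ^ 2)%N.
Proof.
have [/existsP[m /eqP eq_m] _|] := boolP [exists m : 'I_n.+1, (m * m.+1 %/ 2 == n)%N].
  exists m; have /divnK : (2 %| m * m.+1)%N by rewrite dvdn2 oddM /= andbN.
  by rewrite eq_m -mulnn; nia.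
rewrite negb_exists => /forallP no_m /eqP[].
by apply: big1 => m _; rewrite (negbTE (no_m m)).
Qed.

Lemma half_phi_neg4_neq0 n : half_phi_neg4 n != 0 -> exists a, n = (4 * a ^ 2)%N.
Proof.
rewrite /half_phi_neg4 big_mkord.
have [/existsP[t /eqP eq_t] _|] := boolP [exists t : 'I_n, (4 * t.+1 ^ 2 == n)%N].
  by exists t.+1.
rewrite negb_exists => /forallP no_t /eqP[].
by apply: big1 => t _; rewrite (negbTE (no_t t)) mulr0.
Qed.

(** * Quadratic forms and divisibility by [p] *)

(** For odd [n], the residues [b] and [n - b] have opposite parities and equal squares modulo [n];
    [b = 0] is excluded since [n] does not divide [c]. *)
Lemma dvdn_sqrD_parity (e : bool) n a c : odd n -> ~~ (n %| c)%N -> (n %| a ^ 2 + c)%N ->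
  exists b, [/\ odd b = e, (b < n)%N & (n %| b ^ 2 + c)%N].
Proof.
move=> n_odd n_ndvd n_dvd; pose b := (a %% n)%N.
have lt_bn : (b < n)%N by rewrite ltn_mod; case: (n) n_odd.
have b_dvd : (n %| b ^ 2 + c)%N by rewrite /dvdn -modnDml modnXm modnDml.
have [eq_b|neq_b] := eqVneq (odd b) e; first by exists b.
have b_gt0 : (0 < b)%N.
  by rewrite lt0n; apply: contraNneq n_ndvd => b0; rewrite b0 in b_dvd.
exists (n - b)%N; rewrite (oddB (ltnW lt_bn)) n_odd; split.
- by case: (odd b) e neq_b => -[].
- by rewrite ltn_subrL b_gt0 (leq_trans _ lt_bn).
(* Adding the multiple [2 * n * b] of [n] clears the subtraction. *)
rewrite -(dvdn_addl _ (dvdn_mulr b (dvdn_mull 2 (dvdnn n)))).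
have -> : ((n - b) ^ 2 + c + 2 * n * b = n * n + (b ^ 2 + c))%N.
  by rewrite -{2 3 4}(subnK (ltnW lt_bn)); ring.
by rewrite (dvdn_addr _ (dvdn_mulr n (dvdnn n))).
Qed.

(* Descent: a representative [b < n] of [a] of the right parity gives a cofactor
   of [n] in [b ^ 2 + 1] that is smaller than [n] and again [3] modulo [4]. *)
Lemma ndvdn_sqrD1 n a : (n %% 4 = 3)%N -> ~~ (n %| a ^ 2 + 1)%N.
Proof.
elim/ltn_ind: n a => n IHn a n_mod; apply/negP => n_dvd.
have [||b [b_even lt_bn /dvdnP[c eq_c]]] := dvdn_sqrD_parity false _ _ n_dvd.
- by lia.
- by rewrite dvdn1; lia.
have [d eq_b] : exists d, b = (2 * d)%N by exists b./2; lia.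
have c_mod : (c %% 4 = 3)%N by rewrite eq_b -mulnn in eq_c; nia.
have lt_cn : (c < n)%N by rewrite -mulnn in eq_c; nia.
by have /negP[] := IHn c lt_cn b c_mod; rewrite eq_c dvdn_mulr.
Qed.

(** The same descent with [b] odd: the cofactor satisfies [c * n = 3] modulo 8, which exchanges the
    classes 5 and 7, so both are treated together. *)
Lemma ndvdn_sqrD2 n a : (n %% 8 = 5)%N \/ (n %% 8 = 7)%N -> ~~ (n %| a ^ 2 + 2)%N.
Proof.
elim/ltn_ind: n a => n IHn a n_mod; apply/negP => n_dvd.
have [||b [b_odd lt_bn /dvdnP[c eq_c]]] := dvdn_sqrD_parity true _ _ n_dvd.
- by lia.
- by apply/negP => /dvdn_leq; lia.
have [d sqr_b] : exists d, (b ^ 2 = 8 * d + 1)%N.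
  have /dvdnP[d eq_d] : (2 %| b./2 * b./2.+1)%N by rewrite dvdn2 oddM /= andbN.
  by exists d; have -> : b = (2 * b./2 + 1)%N by [lia]; rewrite -mulnn; nia.
have c_mod : (c %% 8 = 5)%N \/ (c %% 8 = 7)%N.
  have : ((c %% 8) * (n %% 8) = 3 %[mod 8])%N by rewrite modnMm -eq_c sqr_b; lia.
  have : (c %% 8 < 8)%N by rewrite ltn_mod.
  by case: n_mod => ->; case: (c %% 8)%N => [|[|[|[|[|[|[|[|?]]]]]]]] //; auto.
have lt_cn : (c < n)%N by rewrite -mulnn in eq_c; nia.
by have /negP[] := IHn c lt_cn b c_mod; rewrite eq_c dvdn_mulr.
Qed.

(** If [p] did not divide [z], an inverse [u] of [z] modulo [p] would make [-d] the square of
    [x * u]. *)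
Lemma prime_dvdn_form p d x z : prime p -> (forall a, ~~ (p %| a ^ 2 + d)%N) ->
  (p %| x ^ 2 + d * z ^ 2)%N -> (p %| x)%N && (p %| z)%N.
Proof.
move=> p_prime p_ndvd p_dvd; have [p_z|p_nz] := boolP (p %| z)%N.
  by move: p_dvd; rewrite dvdn_addl ?Euclid_dvdX ?andbT ?dvdn_mull ?dvdn_exp.
have : coprime z p by rewrite coprime_sym prime_coprime.
case/coprimeP => [|[u v] /= eq_uv]; first by rewrite lt0n; apply: contraNneq p_nz => ->.
have eq_u : (u * z = 1 + v * p)%N by lia.
have /negP[] := p_ndvd (x * u)%N.
rewrite -(@dvdn_addl (p * (d * (2 * v + v * v * p)))) ?dvdn_mulr //.
rewrite (_ : (_ + _ = (x ^ 2 + d * z ^ 2) * u ^ 2)%N) ?dvdn_mulr //.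
have : (d * (u * z) * (u * z) = d * (1 + v * p) * (1 + v * p))%N by rewrite eq_u.
by rewrite -!mulnn; nia.
Qed.

(** Dividing [x] and [y] by [p] removes [p ^ 2] from the right side; the last factor [p] would then
    force [p] to divide [m]. *)
Lemma form_odd_valuation p c k m x y : prime p ->
    (forall x y, (p %| x ^ 2 + c * y ^ 2)%N -> (p %| x)%N && (p %| y)%N) ->
    ~~ (p %| m)%N ->
  (x ^ 2 + c * y ^ 2)%N <> (p ^ (2 * k + 1) * m)%N.
Proof.
move=> p_prime p_form p_ndvd; have p_gt0 := prime_gt0 p_prime.
elim: k x y => [|k IHk] x y eq_xy; have p_dvd : (p %| x ^ 2 + c * y ^ 2)%N.
- by rewrite eq_xy muln0 dvdn_mulr.
- have /andP[/dvdnP[x' eq_x] /dvdnP[y' eq_y]] := p_form x y p_dvd.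
  have eq_m : (m = p * (x' ^ 2 + c * y' ^ 2))%N.
    apply/eqP; rewrite -(eqn_pmul2l p_gt0); move: eq_xy; rewrite muln0 expn1 => <-.
    by rewrite eq_x eq_y; apply/eqP; ring.
  by rewrite eq_m dvdn_mulr in p_ndvd.
- by rewrite eq_xy addn1 expnS -mulnA dvdn_mulr.
have /andP[/dvdnP[x' eq_x] /dvdnP[y' eq_y]] := p_form x y p_dvd.
apply: (IHk x' y'); apply/eqP; rewrite -(eqn_pmul2l p_gt0) -(eqn_pmul2l p_gt0).
apply/eqP; transitivity (x ^ 2 + c * y ^ 2)%N; first by rewrite eq_x eq_y; ring.
rewrite eq_xy; have -> : (2 * k.+1 + 1 = (2 * k + 1).+2)%N by lia.
by rewrite !expnS !mulnA.
Qed.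

(** * Vanishing modulo 8 *)

Lemma dvd8_pod2 p k m N : prime p -> (p %% 8 = 7)%N -> ~~ (p %| m)%N ->
  (8 * N + 1 = p ^ (2 * k + 1) * m)%N -> (8 %| pod2 N)%Z.
Proof.
move=> p_prime p_mod8 p_ndvd eq_N.
have p_ndvd2 e x : (p %| 2 ^ e * x)%N -> (p %| x)%N.
  by rewrite Euclid_dvdM // Euclid_dvdX // => /orP[/andP[/dvdn_leq]|//]; lia.
have no_rep32 x y : (x ^ 2 + 32 * y ^ 2)%N <> (8 * N + 1)%N.
  rewrite eq_N; apply: form_odd_valuation => // {}x {}y.
  have -> : (32 * y ^ 2 = 2 * (2 ^ 2 * y) ^ 2)%N by ring.
  move/(prime_dvdn_form p_prime (fun a => ndvdn_sqrD2 a (or_intror p_mod8))).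
  by case/andP=> -> /p_ndvd2.
have no_rep64 x y : (x ^ 2 + 64 * y ^ 2)%N <> (8 * N + 1)%N.
  rewrite eq_N; apply: form_odd_valuation => // {}x {}y.
  have -> : (64 * y ^ 2 = 1 * (2 ^ 3 * y) ^ 2)%N by ring.
  have p_mod4 : (p %% 4 = 3)%N by lia.
  move/(prime_dvdn_form p_prime (fun a => ndvdn_sqrD1 a p_mod4)).
  by case/andP=> -> /p_ndvd2.
have psi_N : psi N = 0.
  apply/eqP/negPn/negP => /psi_neq0[x eq_x]; apply: (no_rep64 (2 * x + 1)%N 0%N).
  by rewrite eq_x addn0.
have psiT_N : fps_mul psi half_phi_neg4 N = 0.
  apply: big1 => i _; have [->|/psi_neq0[x eq_x]] := eqVneq (psi i) 0.
    by rewrite mul0r.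
  have [->|/half_phi_neg4_neq0[a eq_a]] := eqVneq (half_phi_neg4 (N - i)%N) 0.
    by rewrite mulr0.
  (* Here [N = i + 4 a^2] and [8 i + 1] is a square. *)
  by case: (no_rep32 (2 * x + 1)%N a); have := ltn_ord i; lia.
have psiTT_N : (2 %| fps_mul psi (fps_mul half_phi_neg4 half_phi_neg4) N)%Z.
  apply: rpred_sum => i _; have [z ->] := fps_sqr_mod2 half_phi_neg4 (N - i)%N.
  rewrite mulrDr rpredD //; first by rewrite mulrCA dvdz_mulr.
  have [->|/psi_neq0[x eq_x]] := eqVneq (psi i) 0; first by rewrite mul0r.
  have [|even_Ni] := boolP (odd (N - i)%N); first by rewrite mul0r mulr0.
  have [->|/half_phi_neg4_neq0[a eq_a]] := eqVneq (half_phi_neg4 (N - i)%N./2) 0.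
    by rewrite expr0n !mulr0.
  (* The diagonal term has [N - i = 2 (4 a^2)], whence [64 a^2] in [8 N + 1]. *)
  by case: (no_rep64 (2 * x + 1)%N a); have := ltn_ord i; lia.
have [z ->] := pod2_mod8 N; have /dvdzP[w ->] := psiTT_N.
by rewrite psi_N psiT_N; apply/dvdzP; exists (w + z); ring.
Qed.

Local Close Scope ring_scope.

Theorem theorem1p4 (p r : nat) (p_prime : prime p) (p_mod8 : p = 7 %[mod 8])
    (r_bounds : 1 <= r < 8 * p) (r_mod8 : r = 7 %[mod 8])
    (r_coprime : coprime r p) (n k : nat) :
  (pod2 (p ^ (2 * k + 2) * n + (r * p ^ (2 * k + 1) - 1) %/ 8)%N
     = 0 %[mod 8])%Z.
Proof.
apply/eqP; rewrite eqz_mod_dvd subr0.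
(* Since [7 * 7 = 1] modulo 8, the division by 8 in the index is exact. *)
have rp_mod8 : r * p ^ (2 * k + 1) = 1 %[mod 8].
  have p_sqr : p ^ (2 * k) = 1 %[mod 8].
    have sqr_mod8 : p ^ 2 %% 8 = 1 by rewrite -modnXm p_mod8.
    by rewrite expnM -modnXm sqr_mod8 exp1n.
  by rewrite addn1 expnS mulnA -modnMm -(modnMm r p) r_mod8 p_mod8 p_sqr.
(* For the index [N], [8 N + 1] factors as [p ^ (2 * k + 1) * (8 * p * n + r)]. *)
apply: (@dvd8_pod2 p k (8 * p * n + r)) => //.
  rewrite dvdn_addr; last by rewrite mulnAC dvdn_mull.
  by rewrite -prime_coprime // coprime_sym.
have [d eq_d] : exists d, r * p ^ (2 * k + 1) = d * 8 + 1.
  by exists (r * p ^ (2 * k + 1) %/ 8); rewrite {1}(divn_eq (_ * _) 8) rp_mod8.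
have -> : 2 * k + 2 = (2 * k + 1).+1 by rewrite addnS.
by rewrite [RHS]mulnDr [X in _ = _ + X]mulnC eq_d addnK mulnK // expnS; ring.
Qed.
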